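(* Let $K$ be a locally compact Hausdorff topological space which is not $\sigma$-compact and in which every countable family of compact sets is contained in some compact set. Let $\dot{C_0}(K)$ denote the unitization of the $C^*$-algebra $C_0(K)$, and consider $C_0(K)$ as a Hilbert $C^*$-module over $\dot{C_0}(K)$. Then there is no standard frame in the $\dot{C_0}(K)$-module $C_0(K)$.
   Context: $C_0(K)$ is the $C^*$-algebra of continuous complex-valued functions on $K$ vanishing at infinity, with the sup norm. It is a Hilbert module over its unitization $\dot{C_0}(K)$ via multiplication and the inner product $\langle a,b\rangle=a^*b$. ''Every countable family of compact sets is contained in some compact set'' means that for any compact $K_1,K_2,\dots\subset K$ there is a compact $K'\subset K$ with $\bigcup_n K_n\subset K'$. Standard frame: let $\mathcal N$ be a Hilbert $C^*$-module over a unital $C^*$-algebra $\mathcal A$ and let $J$ be a set (of arbitrary cardinality). A family $\{x_j\}_{j\in J}$ of elements of $\mathcal N$ is a standard frame in $\mathcal N$ if there are positive constants $c_1,c_2$ such that for every $x\in\mathcal N$ the series $\sum_{j\in J}\langle x,x_j\rangle\langle x_j,x\rangle$ converges in norm in $\mathcal A$ (as the net of its finite partial sums) and $$c_1\langle x,x\rangle\le\sum_{j\in J}\langle x,x_j\rangle\langle x_j,x\rangle\le c_2\langle x,x\rangle.$$ *)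

(* Defs.v *)
From HB Require Import structures.
From mathcomp Require Import all_boot all_order all_algebra.
From mathcomp Require Import complex finmap ring.
From mathcomp Require Import boolp classical_sets functions reals topology.
From mathcomp Require Import normedtype.
From mathcomp.analysis.showcase Require summability.

Set Implicit Arguments.
Unset Strict Implicit.
Unset Printing Implicit Defensive.

Import Order.TTheory GRing.Theory Num.Theory.
Import numFieldNormedType.Exports.

Local Open Scope classical_set_scope.
Local Open Scope complex_scope.
Local Open Scope ring_scope.

HB.instance Definition _ (R : realType) := NormedModule.copy R[i] R[i]^o.

Section Modulus.
Variable R : realType.
Implicit Types z w : R[i].

(* Norms of normedModType R[i] are R[i]-valued; this is the modulus in R. *)
Definition modulus z : R := complex.Re `|z|.

Lemma modulusE z : (modulus z)%:C = `|z|.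
Proof.
have := normr_ge0 z; rewrite /modulus.
by case: (`|z|) => a b; rewrite lecE /= => /andP[/eqP -> _].
Qed.

Lemma modulus_ge0 z : 0 <= modulus z.
Proof. by rewrite -lecR modulusE; exact: normr_ge0. Qed.

Lemma modulusD z w : modulus (z + w) <= modulus z + modulus w.
Proof. by rewrite -lecR rmorphD/= !modulusE ler_normD. Qed.

Lemma modulusM z w : modulus (z * w) = modulus z * modulus w.
Proof. by apply: complexI; rewrite rmorphM/= !modulusE normrM. Qed.

Lemma modulusJ z : modulus z^* = modulus z.
Proof. by rewrite /modulus normcJ. Qed.

Lemma modulusN z : modulus (- z) = modulus z.
Proof. by rewrite /modulus normrN. Qed.

Lemma modulus_dist z w : `|modulus z - modulus w| <= modulus (z - w).
Proof.
have D a b : modulus a - modulus b <= modulus (a - b).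
  by rewrite lerBlDr -{1}(subrK b a) modulusD.
by rewrite ler_norml lerNl opprB D andbT -[leRHS]modulusN opprB D.
Qed.

Lemma modulus_eq0 z : modulus z = 0 -> z = 0.
Proof. by move=> z0; apply: normr0_eq0; rewrite -modulusE z0. Qed.

Lemma modulus_lt z (e : R) : (`|z| < e%:C) = (modulus z < e).
Proof. by rewrite -modulusE ltcR. Qed.

Lemma gt0_complex (e : R[i]) : 0 < e -> exists2 r : R, 0 < r & e = r%:C.
Proof.
by case: e => a b; rewrite ltcE /= => /andP[/eqP -> a0]; exists a.
Qed.

Lemma complex_complete (F : set_system R[i]) :
  ProperFilter F -> cauchy F -> cvg F.
Proof.
move=> FF /cauchyP Fc.
have cp (p : R[i] -> R) : (forall z w, `|p z - p w| <= modulus (z - w)) ->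
    cvg (p @ F).
  move=> pE; apply/cauchy_cvgP; apply: cauchy_exP => e e0.
  have [z Fz] := Fc e%:C (etrans (ltcR _ _) e0).
  exists (p z); suff: F (p @^-1` ball (p z) e) by [].
  apply: filterS Fz => w.
  change (`|z - w| < e%:C -> `|p z - p w| < e).
  by rewrite modulus_lt; exact: le_lt_trans.
have cRe : cvg (@complex.Re R @ F).
  apply: cp => -[a b] [c d]; rewrite /modulus normc_def /= -sqrtr_sqr.
  by rewrite ler_wsqrtr// lerDl sqr_ge0.
have cIm : cvg (@complex.Im R @ F).
  apply: cp => -[a b] [c d]; rewrite /modulus normc_def /= -sqrtr_sqr.
  by rewrite ler_wsqrtr// lerDr sqr_ge0.
apply/cvg_ex; exists (lim (@complex.Re R @ F) +i* lim (@complex.Im R @ F)).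
apply/cvgrPdist_lt => _ /gt0_complex [r r0 ->].
have r2 : 0 < r / 2 by rewrite divr_gt0.
move/cvgrPdist_lt: cRe => /(_ _ r2) FRe.
move/cvgrPdist_lt: cIm => /(_ _ r2) FIm.
near=> z; rewrite modulus_lt.
have -> : lim (@complex.Re R @ F) +i* lim (@complex.Im R @ F) - z =
    (lim (@complex.Re R @ F) - complex.Re z)%:C +
    'i%C * (lim (@complex.Im R @ F) - complex.Im z)%:C.
  by case: (z) => a b; simpc.
apply: le_lt_trans (modulusD _ _) _; rewrite modulusM.
have -> : modulus 'i%C = 1 :> R.
  by rewrite /modulus normc_def/= expr0n expr1n/= add0r sqrtr1.
have mR (x : R) : modulus x%:C = `|x|.
  by rewrite /modulus normc_def/= expr0n/= addr0 sqrtr_sqr.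
rewrite mul1r !mR [r]splitr ltrD//; near: z; [exact: FRe|exact: FIm].
Unshelve. all: by end_near. Qed.

End Modulus.

Arguments modulus {R} z.

HB.instance Definition _ (R : realType) :=
  Uniform_isComplete.Build R[i] (@complex_complete R).

Section SupNorm.
Variables (R : realType) (T : Type).
Implicit Types f g : T -> R[i].

Definition supnorm f : R := sup (range (modulus \o f)).

Definition bounded_modulus f := exists M : R, forall t, modulus (f t) <= M.

Lemma supnorm_ub f t : bounded_modulus f -> modulus (f t) <= supnorm f.
Proof.
move=> [M fM]; apply: ub_le_sup; last by exists t.
by exists M => _ [s _ <-]; exact: fM.
Qed.

Lemma supnorm_le f (M : R) :
  0 <= M -> (forall t, modulus (f t) <= M) -> supnorm f <= M.
Proof.
move=> M0 fM; have [[t]|noT] := pselect (inhabited T).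
  apply: ge_sup; first by exists (modulus (f t)), t.
  by move=> _ [s _ <-]; exact: fM.
rewrite /supnorm (_ : range _ = set0) ?sup0//.
by apply/seteqP; split=> // x [t]; case: noT.
Qed.

Lemma supnorm_ge0 f : bounded_modulus f -> 0 <= supnorm f.
Proof.
move=> fb; have [[t]|noT] := pselect (inhabited T).
  exact: le_trans (modulus_ge0 _) (supnorm_ub t fb).
rewrite /supnorm (_ : range _ = set0) ?sup0//.
by apply/seteqP; split=> // x [t]; case: noT.
Qed.

Lemma supnormD f g : bounded_modulus f -> bounded_modulus g ->
  supnorm (f + g) <= supnorm f + supnorm g.
Proof.
move=> fb gb; apply: supnorm_le => [|t]; first by rewrite addr_ge0 ?supnorm_ge0.
by apply: le_trans (modulusD _ _) _; rewrite lerD ?supnorm_ub.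
Qed.

Lemma supnormM f g : bounded_modulus f -> bounded_modulus g ->
  supnorm (f * g) <= supnorm f * supnorm g.
Proof.
move=> fb gb; apply: supnorm_le => [|t]; first by rewrite mulr_ge0 ?supnorm_ge0.
by rewrite [_ t]/(f t * g t) modulusM ler_pM ?modulus_ge0 ?supnorm_ub.
Qed.

Lemma supnormZ (k : R[i]) f : bounded_modulus f ->
  supnorm (k *: f) = modulus k * supnorm f.
Proof.
move=> fb; have kfE t : modulus ((k *: f) t) = modulus k * modulus (f t).
  by rewrite -modulusM.
apply/eqP; rewrite eq_le; apply/andP; split.
  apply: supnorm_le => [|t]; first by rewrite mulr_ge0 ?modulus_ge0 ?supnorm_ge0.
  by rewrite kfE ler_wpM2l ?modulus_ge0 ?supnorm_ub.
have kfb : bounded_modulus (k *: f).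
  exists (modulus k * supnorm f) => t.
  by rewrite kfE ler_wpM2l ?modulus_ge0 ?supnorm_ub.
have [k0|k0] := eqVneq (modulus k) 0; first by rewrite k0 mul0r supnorm_ge0.
have kgt0 : 0 < modulus k by rewrite lt_neqAle eq_sym k0 modulus_ge0.
rewrite mulrC -ler_pdivlMr//; apply: supnorm_le => [|t].
  by rewrite divr_ge0 ?supnorm_ge0 ?modulus_ge0.
by rewrite ler_pdivlMr// mulrC -kfE supnorm_ub.
Qed.

Lemma supnorm_eq0 f : bounded_modulus f -> supnorm f = 0 -> f = 0.
Proof.
move=> fb f0; apply/funext => t; apply: modulus_eq0.
by apply/eqP; rewrite eq_le modulus_ge0 andbT -f0 supnorm_ub.
Qed.

Lemma supnorm_sqr f : bounded_modulus f ->
  supnorm (fun t => (f t)^* * f t) = supnorm f ^+ 2.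
Proof.
move=> fb.
have fE t : modulus ((f t)^* * f t) = modulus (f t) ^+ 2.
  by rewrite modulusM modulusJ -expr2.
have f2b : bounded_modulus (fun t => (f t)^* * f t).
  exists (supnorm f ^+ 2) => t.
  by rewrite fE lerXn2r ?nnegrE ?modulus_ge0 ?supnorm_ge0 ?supnorm_ub.
apply/eqP; rewrite eq_le; apply/andP; split.
  apply: supnorm_le => [|t]; first by rewrite sqr_ge0.
  by rewrite fE lerXn2r ?nnegrE ?modulus_ge0 ?supnorm_ge0 ?supnorm_ub.
rewrite -[leRHS]sqr_sqrtr ?supnorm_ge0//.
rewrite lerXn2r ?nnegrE ?sqrtr_ge0 ?supnorm_ge0//.
apply: supnorm_le => [|t]; first exact: sqrtr_ge0.
rewrite -[leLHS]ger0_norm ?modulus_ge0// -sqrtr_sqr ler_wsqrtr// -fE.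
exact: supnorm_ub t f2b.
Qed.

End SupNorm.

Arguments supnorm {R T} f.
Arguments bounded_modulus {R T} f.

(* Unital C*-algebras; the product is a field of the mixin because GRing.Algebra cannot be joined
   with NormedModule: Num.NumDomain already inherits from both. *)
HB.mixin Record isCStarAlgebra (R : realType) A & CompleteNormedModule R[i] A := {
  cmul : A -> A -> A;
  cone : A;
  cstar : A -> A;
  cmulA : associative cmul;
  cmul1l : left_id cone cmul;
  cmul1r : right_id cone cmul;
  cmulDl : left_distributive cmul +%R;
  cmulDr : right_distributive cmul +%R;
  cmulZl : forall (k : R[i]) (a b : A), cmul (k *: a) b = k *: cmul a b;
  cmulZr : forall (k : R[i]) (a b : A), cmul a (k *: b) = k *: cmul a b;
  cstarK : involutive cstar;
  cstarD : {morph cstar : a b / a + b};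
  cstarZ : forall (k : R[i]) (a : A), cstar (k *: a) = k^* *: cstar a;
  cstarM : forall a b : A, cstar (cmul a b) = cmul (cstar b) (cstar a);
  cnormM : forall a b : A, `|cmul a b| <= `|a| * `|b|;
  cnorm_star : forall a : A, `|cmul (cstar a) a| = `|a| ^+ 2
}.

#[short(type="cstarAlgType")]
HB.structure Definition CStarAlgebra (R : realType) :=
  {A of CompleteNormedModule R[i] A & isCStarAlgebra R A}.

Declare Scope cstar_scope.
Delimit Scope cstar_scope with cstar.

Notation "a ** b" := (cmul a b) (at level 40, left associativity) : cstar_scope.

Definition cpositive (R : realType) (A : cstarAlgType R) (a : A) :=
  exists c : A, a = cmul (cstar c) c.

Definition cle (R : realType) (A : cstarAlgType R) (a b : A) :=
  cpositive (b - a).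

Notation "a <=* b" := (cle a b) (at level 70, no associativity) : cstar_scope.

Local Open Scope cstar_scope.

(* Right modules, with an inner product linear in its second argument.  By
   [norm_inner], completeness is completeness for ||<x, x>||^(1/2). *)
HB.mixin Record isHilbertModule (R : realType) (A : cstarAlgType R) N
    & CompleteNormedModule R[i] N := {
  act : N -> A -> N;
  actDl : forall x y a, act (x + y) a = act x a + act y a;
  actDr : forall x a b, act x (a + b) = act x a + act x b;
  actM : forall x a b, act x (a ** b) = act (act x a) b;
  actZ1 : forall x (k : R[i]), act x (k *: cone) = k *: x;
  inner : N -> N -> A;
  innerD : forall x y z, inner x (y + z) = inner x y + inner x z;
  inner_act : forall x y a, inner x (act y a) = inner x y ** a;
  inner_star : forall x y, inner y x = cstar (inner x y);
  inner_pos : forall x, cpositive (inner x x);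
  norm_inner : forall x : N, `|x| ^+ 2 = `|inner x x|
}.

#[short(type="hilbertModType")]
HB.structure Definition HilbertModule (R : realType) (A : cstarAlgType R) :=
  {N of CompleteNormedModule R[i] N & isHilbertModule R A N}.

Definition frame_coef (R : realType) (A : cstarAlgType R)
    (N : hilbertModType A) (J : choiceType) (x : J -> N) (y : N) (j : J) : A :=
  inner y (x j) ** inner (x j) y.

(* [summability.totally] is the filter of the directed set {fset J} under
   inclusion, so [summability.sum] is the norm limit of the net of finite
   partial sums. *)
Definition standard_frame (R : realType) (A : cstarAlgType R)
    (N : hilbertModType A) (J : choiceType) (x : J -> N) :=
  exists c1 c2 : R, [/\ 0 < c1, 0 < c2 & forall y : N,
    [/\ cvg (summability.partial_sum (frame_coef x y) @ summability.totally),
        c1%:C *: (inner y y : A) <=* summability.sum (frame_coef x y)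
      & summability.sum (frame_coef x y) <=* c2%:C *: (inner y y : A)]].

Definition sigma_compact (T : topologicalType) (A : set T) :=
  exists2 B : nat -> set T, (forall n, compact (B n)) & A = \bigcup_n B n.

Section C0.
Variables (R : realType) (K : topologicalType).

Definition vanishes_at_infinity (f : K -> R[i]) :=
  forall e : R, 0 < e ->
    exists2 B : set K, compact B & forall t, ~ B t -> `|f t| < e%:C.

Definition C0_pred : {pred K -> R[i]} :=
  [pred f | `[< continuous f /\ vanishes_at_infinity f >]].

Record C0 := MkC0 { C0_fun :> K -> R[i]; _ : C0_fun \in C0_pred }.

HB.instance Definition _ := [isSub for C0_fun].
HB.instance Definition _ := [Choice of C0 by <:].

Lemma C0P (f : C0) : continuous f /\ vanishes_at_infinity f.
Proof. by case: f => f fP; exact: (asboolW fP). Qed.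

Lemma C0_ext (f g : C0) : f =1 g -> f = g.
Proof. by move=> fg; apply: val_inj; apply/funext. Qed.

Lemma C0_bounded (f : C0) : bounded_modulus f.
Proof.
have [fc fv] := C0P f.
have [B Bc fB] := fv 1 ltr01.
have : compact ((modulus \o f) @` B).
  apply: continuous_compact => //; apply: continuous_subspaceT => t.
  apply/cvgrPdist_lt => e e0.
  have /cvgrPdist_lt/(_ e%:C) := fc t; rewrite ltcR => /(_ e0).
  apply: filterS => s; rewrite modulus_lt; apply: le_lt_trans.
  exact: modulus_dist.
move=> /compact_bounded[M [_ MB]].
exists (Num.max 1 (M + 1)) => t; have [Bt|nBt] := pselect (B t).
  rewrite le_max; apply/orP; right.
  have := MB (M + 1); rewrite ltrDl ltr01 => /(_ isT (modulus (f t))).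
  rewrite /= ger0_norm ?modulus_ge0//; apply; by exists t.
by rewrite le_max; apply/orP; left; rewrite ltW// -modulus_lt; exact: fB.
Qed.

Lemma vanishes_le (h f g : K -> R[i]) (c : R) : 0 <= c ->
    (forall t, modulus (h t) <= c * modulus (f t) + modulus (g t)) ->
  vanishes_at_infinity f -> vanishes_at_infinity g -> vanishes_at_infinity h.
Proof.
move=> c0 hfg fv gv e e0.
have d0 : 0 < e / 2 by rewrite divr_gt0.
have c1 : 0 < c + 1 by rewrite ltr_wpDl.
have [B Bc fB] := fv (e / 2 / (c + 1)) (divr_gt0 d0 c1).
have [D Dc gD] := gv _ d0.
  have BD : compact (B `|` D) by apply: (@compactU _ B D).
  exists (B `|` D) => //.
move=> t /not_orP[nB nD]; rewrite modulus_lt; apply: le_lt_trans (hfg t) _.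
have := fB _ nB; have := gD _ nD; rewrite !modulus_lt => gt ft.
rewrite [e]splitr ler_ltD//; apply: (@le_trans _ _ ((c + 1) * modulus (f t))).
  by rewrite ler_wpM2r ?modulus_ge0// lerDl.
by rewrite mulrC -ler_pdivlMr// ltW.
Qed.

Lemma C0_submod_closed : GRing.submod_closed C0_pred.
Proof.
split=> [|k f g /asboolW[fc fv] /asboolW[gc gv]]; apply/asboolP; split.
- by move=> t; exact: (@cst_continuous _ _ (0 : R[i])).
- move=> e e0; exists set0; first exact: compact0.
  by move=> t _; rewrite normr0 ltcR.
- move=> t; apply: cvgD; last exact: gc.
  by apply: cvgZl_tmp; exact: fc.
- apply: (vanishes_le (modulus_ge0 k) _ fv gv) => t.
  by rewrite -modulusM modulusD.
Qed.

HB.instance Definition _ :=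
  GRing.isSubmodClosed.Build _ (K -> R[i]) C0_pred C0_submod_closed.
HB.instance Definition _ := [SubChoice_isSubLmodule of C0 by <:].

Fact C0_normD (f g : C0) :
  (supnorm (f + g))%:C <= (supnorm f)%:C + (supnorm g)%:C.
Proof. by rewrite -rmorphD lecR supnormD//; exact: C0_bounded. Qed.

Fact C0_normZ (k : R[i]) (f : C0) :
  (supnorm (k *: f))%:C = `|k| * (supnorm f)%:C.
Proof. by rewrite supnormZ ?rmorphM/= ?modulusE//; exact: C0_bounded. Qed.

Fact C0_norm_eq0 (f : C0) : (supnorm f)%:C = 0 -> f = 0.
Proof.
by move=> /complexI /(supnorm_eq0 (C0_bounded f)) f0; exact: val_inj.
Qed.

HB.instance Definition _ := @Lmodule_isNormed.Build R[i] C0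
  (fun f => (supnorm f)%:C) C0_normD C0_normZ C0_norm_eq0.

Lemma C0_normE (f : C0) : `|f| = (supnorm f)%:C.
Proof. by []. Qed.

Lemma C0_ub (f : C0) t : `|f t| <= `|f|.
Proof. by rewrite C0_normE -modulusE lecR supnorm_ub//; exact: C0_bounded. Qed.

Lemma C0_complete (F : set_system C0) : ProperFilter F -> cauchy F -> cvg F.
Proof.
move=> FF /cauchyP Fc.
have evc (t : K) : cvg ((fun f : C0 => f t) @ F).
  apply/cauchy_cvgP; apply: cauchy_exP => e e0.
  have [f Ff] := Fc e e0.
  exists (f t); suff: F ((fun g : C0 => g t) @^-1` ball (f t) e) by [].
  apply: filterS Ff => g; rewrite -!ball_normE /=.
  exact: le_lt_trans (C0_ub (f - g) t).
pose l t := lim ((fun f : C0 => f t) @ F).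
have Fl (e : R) : 0 < e -> exists2 f : C0, F (ball f e%:C) &
    forall t, modulus (l t - f t) <= e.
  move=> e0; have e0' : 0 < e%:C by rewrite ltcR.
  have [f Ff] := Fc _ e0'; exists f => // t.
  apply/ler_addgt0Pr => d d0.
  have /cvgrPdist_lt/(_ d%:C) := evc t; rewrite ltcR => /(_ d0) Fd.
  have [g [fg gl]] := filter_ex (filterI Ff Fd).
  move: fg; rewrite -ball_normE /= => fg.
  have -> : l t - f t = (l t - g t) - (f t - g t) by rewrite opprB addrA subrK.
  apply: le_trans (modulusD _ _) _; rewrite modulusN addrC lerD//.
    rewrite ltW// -modulus_lt; apply: le_lt_trans fg; exact: C0_ub (f - g) t.
  by rewrite ltW// -modulus_lt.
have lP : l \in C0_pred.
  apply/asboolP; split=> [t|e e0].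
    apply/cvgrPdist_lt => _ /gt0_complex[e e0 ->].
    have e3 : 0 < e / 3 by rewrite divr_gt0.
    have [f _ lf] := Fl _ e3; have [fc _] := C0P f.
    have /cvgrPdist_lt/(_ (e / 3)%:C) := fc t; rewrite ltcR => /(_ e3).
    apply: filterS => s; rewrite !modulus_lt => fts.
    have -> : l t - l s = (l t - f t) + ((f t - f s) - (l s - f s)).
      by rewrite opprB !addrA !subrK.
    have -> : e = e / 3 + (e / 3 + e / 3) by field.
    apply: le_lt_trans (modulusD _ _) _; rewrite ler_ltD//.
    apply: le_lt_trans (modulusD _ _) _; rewrite ltr_leD// modulusN.
    exact: lf.
  have e2 : 0 < e / 2 by rewrite divr_gt0.
  have [f _ lf] := Fl _ e2; have [_ fv] := C0P f.
  have [B Bc fB] := fv _ e2; exists B => // t /fB.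
  rewrite !modulus_lt => ft; rewrite -[l t](subrK (f t)).
  by apply: le_lt_trans (modulusD _ _) _; rewrite [e]splitr ler_ltD.
apply/cvg_ex; exists (MkC0 lP); apply/cvgrPdist_le => _ /gt0_complex[e e0 ->].
have e2 : 0 < e / 2 by rewrite divr_gt0.
have [f Ff lf] := Fl _ e2; apply: filterS Ff => g.
rewrite -ball_normE /= => fg; rewrite C0_normE lecR.
apply: supnorm_le => [|t]; first exact: ltW.
have -> : (MkC0 lP - g) t = (l t - f t) + (f - g) t by rewrite /= addrA subrK.
apply: le_trans (modulusD _ _) _; rewrite [e]splitr lerD//.
by rewrite ltW// -modulus_lt; apply: le_lt_trans fg; exact: C0_ub.
Qed.

HB.instance Definition _ := Uniform_isComplete.Build C0 C0_complete.

Fact C0_mul_subproof (f g : C0) : (fun t => f t * g t) \in C0_pred.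
Proof.
have [[fc fv] [gc gv]] := (C0P f, C0P g); apply/asboolP; split=> [t|].
  by apply: cvgM; [exact: fc|exact: gc].
have fb := C0_bounded f.
apply: (vanishes_le (supnorm_ge0 fb) _ gv (C0P 0).2) => t.
rewrite [modulus (_ 0 _)]/modulus normr0 addr0 modulusM.
by rewrite ler_wpM2r ?modulus_ge0 ?supnorm_ub.
Qed.

Definition C0_mul (f g : C0) : C0 := MkC0 (C0_mul_subproof f g).

Fact C0_conj_subproof (f : C0) : (fun t => (f t)^*) \in C0_pred.
Proof.
have [fc fv] := C0P f; apply/asboolP; split=> [t|].
  apply/cvgrPdist_lt => e e0.
  have /cvgrPdist_lt/(_ e e0) := fc t; apply: filterS => s.
  by rewrite -rmorphB normcJ.
apply: (vanishes_le ler01 _ fv (C0P 0).2) => t.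
by rewrite [modulus (_ 0 _)]/modulus normr0 addr0 mul1r modulusJ.
Qed.

Definition C0_conj (f : C0) : C0 := MkC0 (C0_conj_subproof f).

Lemma C0_addE (f g : C0) t : (f + g) t = f t + g t. Proof. by []. Qed.

Lemma C0_scaleE (k : R[i]) (f : C0) t : (k *: f) t = k * f t. Proof. by []. Qed.

Lemma C0_mulE (f g : C0) t : C0_mul f g t = f t * g t. Proof. by []. Qed.

Lemma C0_conjE (f : C0) t : C0_conj f t = (f t)^*. Proof. by []. Qed.

Definition C0E := (C0_addE, C0_scaleE, C0_mulE, C0_conjE).

End C0.

Section Unitization.
Variables (R : realType) (K : topologicalType).
Local Notation C0 := (C0 R K).

(* [Unitize f k] stands for f + k1. *)
Record unitization := Unitize { upart : C0; uscalar : R[i] }.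

Definition pair_of_unitization (u : unitization) := (upart u, uscalar u).
Definition unitization_of_pair p := Unitize p.1 p.2.

Fact pair_of_unitizationK : cancel pair_of_unitization unitization_of_pair.
Proof. by case. Qed.

HB.instance Definition _ := Choice.copy unitization
  (can_type pair_of_unitizationK).

Implicit Types u v w : unitization.

Definition uadd u v := Unitize (upart u + upart v) (uscalar u + uscalar v).
Definition uopp u := Unitize (- upart u) (- uscalar u).
Definition uscale (k : R[i]) u := Unitize (k *: upart u) (k *: uscalar u).
Definition umul u v :=
  Unitize (C0_mul (upart u) (upart v) + uscalar u *: upart v
           + uscalar v *: upart u)
          (uscalar u * uscalar v).
Definition ustar u := Unitize (C0_conj (upart u)) (uscalar u)^*.

(* Extension of f + k1 to the one-point compactification of K, [None] being
   the point at infinity.  Its sup norm is the unique C*-norm of the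
   unitization; when K is not compact it is sup_t |f t + k|, the norm of the
   multiplication operator g |-> f g + k g of C_0(K). *)
Definition uext u (o : option K) : R[i] :=
  if o is Some t then upart u t + uscalar u else uscalar u.

Lemma uext_inj : injective uext.
Proof.
case=> [f k] [g l] fg; have kl := congr1 (@^~ None) fg; rewrite /= in kl.
congr Unitize => //; apply: C0_ext => t.
by have := congr1 (@^~ (Some t)) fg; rewrite /= kl => /addIr.
Qed.

Fact uaddA : associative uadd.
Proof. by move=> [a k] [b l] [c m]; rewrite /uadd/= !addrA. Qed.

Fact uaddC : commutative uadd.
Proof. by move=> [a k] [b l]; rewrite /uadd/= addrC [k + l]addrC. Qed.

Fact uadd0 : left_id (Unitize 0 0) uadd.
Proof. by move=> [a k]; rewrite /uadd/= !add0r. Qed.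

Fact uaddN : left_inverse (Unitize 0 0) uopp uadd.
Proof. by move=> [a k]; rewrite /uadd/= !addNr. Qed.

HB.instance Definition _ :=
  GRing.isZmodule.Build unitization uaddA uaddC uadd0 uaddN.

Fact uscaleA k l u : uscale k (uscale l u) = uscale (k * l) u.
Proof. by case: u => a m; rewrite /uscale/= !scalerA. Qed.

Fact uscale1 : left_id 1 uscale.
Proof. by move=> [a m]; rewrite /uscale/= !scale1r. Qed.

Fact uscaleDr : right_distributive uscale +%R.
Proof. by move=> k [a l] [b m]; congr Unitize; rewrite scalerDr. Qed.

Fact uscaleDl u : {morph uscale^~ u : k l / k + l}.
Proof. by move=> k l; congr Unitize; rewrite /= scalerDl. Qed.

HB.instance Definition _ := GRing.Zmodule_isLmodule.Build R[i] unitization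
  uscaleA uscale1 uscaleDr uscaleDl.

Lemma uextD u v : uext (u + v) = uext u + uext v.
Proof. by apply/funext => -[t|] //; rewrite /uext/= addrACA. Qed.

Lemma uextZ k u : uext (k *: u) = k *: uext u.
Proof. by apply/funext => -[t|] //; rewrite /= -scalerDr. Qed.

Lemma uextM u v : uext (umul u v) = uext u * uext v.
Proof.
apply/funext => -[t|] //.
change (upart u t * upart v t + uscalar u * upart v t + uscalar v * upart u t
  + uscalar u * uscalar v
  = (upart u t + uscalar u) * (upart v t + uscalar v)); ring.
Qed.

Lemma uext_star u : uext (ustar u) = (fun o => (uext u o)^*).
Proof. by apply/funext => -[t|] //=; rewrite rmorphD. Qed.

Lemma uext_bounded u : bounded_modulus (uext u).
Proof.
have ub := C0_bounded (upart u).
exists (supnorm (upart u) + modulus (uscalar u)) => -[t|] /=.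
  by apply: le_trans (modulusD _ _) _; rewrite lerD2r supnorm_ub.
by rewrite lerDr supnorm_ge0.
Qed.

Fact unormD u v :
  (supnorm (uext (u + v)))%:C <= (supnorm (uext u))%:C + (supnorm (uext v))%:C.
Proof. by rewrite -rmorphD lecR uextD supnormD//; exact: uext_bounded. Qed.

Fact unormZ (k : R[i]) u :
  (supnorm (uext (k *: u)))%:C = `|k| * (supnorm (uext u))%:C.
Proof.
by rewrite uextZ supnormZ ?rmorphM/= ?modulusE//; exact: uext_bounded.
Qed.

Fact unorm_eq0 u : (supnorm (uext u))%:C = 0 -> u = 0.
Proof.
move=> /complexI /(supnorm_eq0 (uext_bounded u)) u0; apply: uext_inj.
by rewrite u0; apply/funext => -[t|] //=; rewrite addr0.
Qed.

HB.instance Definition _ := @Lmodule_isNormed.Build R[i] unitization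
  (fun u => (supnorm (uext u))%:C) unormD unormZ unorm_eq0.

Lemma unormE u : `|u| = (supnorm (uext u))%:C.
Proof. by []. Qed.

Lemma uscalar_le u : `|uscalar u| <= `|u|.
Proof.
rewrite unormE -modulusE lecR.
exact: (supnorm_ub None (uext_bounded u)).
Qed.

Lemma upart_le u : `|upart u| <= `|u| + `|u|.
Proof.
rewrite unormE C0_normE -rmorphD lecR.
have u0 := supnorm_ge0 (uext_bounded u).
apply: supnorm_le => [|t]; first by rewrite addr_ge0.
have -> : upart u t = uext u (Some t) - uext u None by rewrite /= addrK.
apply: le_trans (modulusD _ _) _; rewrite modulusN.
by rewrite lerD ?supnorm_ub//; exact: uext_bounded.
Qed.

Lemma unorm_le (f : C0) (k : R[i]) : `|Unitize f k| <= `|f| + `|k|.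
Proof.
rewrite unormE C0_normE -(modulusE k) -rmorphD lecR.
have f0 := supnorm_ge0 (C0_bounded f).
apply: supnorm_le => [|[t|]] /=; first by rewrite addr_ge0 ?modulus_ge0.
  apply: le_trans (modulusD _ _) _; rewrite lerD2r supnorm_ub//.
  exact: C0_bounded.
by rewrite lerDr.
Qed.

Lemma unitization_complete (F : set_system unitization) :
  ProperFilter F -> cauchy F -> cvg F.
Proof.
move=> FF /cauchyP Fc.
have cs : cvg (uscalar @ F).
  apply/cauchy_cvgP; apply: cauchy_exP => e e0; have [u Fu] := Fc e e0.
  exists (uscalar u); suff: F (uscalar @^-1` ball (uscalar u) e) by [].
  apply: filterS Fu => v; rewrite -!ball_normE /=.
  exact: le_lt_trans (uscalar_le (u - v)).
have cp : cvg (upart @ F).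
  apply/cauchy_cvgP; apply: cauchy_exP => e e0.
  have [u Fu] := Fc (e / 2) (divr_gt0 e0 (ltr0n _ 2)).
  exists (upart u); suff: F (upart @^-1` ball (upart u) e) by [].
  apply: filterS Fu => v; rewrite -!ball_normE /= => uv.
  by apply: le_lt_trans (upart_le (u - v)) _; rewrite [e]splitr ltrD.
apply/cvg_ex; exists (Unitize (lim (upart @ F)) (lim (uscalar @ F))).
apply/cvgrPdist_lt => e e0; have e2 : 0 < e / 2 by rewrite divr_gt0.
move/cvgrPdist_lt: cs => /(_ _ e2) Fs; move/cvgrPdist_lt: cp => /(_ _ e2) Fp.
near=> u; apply: le_lt_trans (unorm_le _ _) _.
by rewrite [e]splitr ltrD//; near: u.
Unshelve. all: by end_near. Qed.

HB.instance Definition _ :=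
  Uniform_isComplete.Build unitization unitization_complete.

Fact umulA : associative umul.
Proof. by move=> u v w; apply: uext_inj; rewrite !uextM mulrA. Qed.

Lemma uext1 : uext (Unitize 0 1) = 1.
Proof. by apply/funext => -[t|] //=; rewrite add0r. Qed.

Fact umul1l : left_id (Unitize 0 1) umul.
Proof. by move=> u; apply: uext_inj; rewrite !uextM uext1 mul1r. Qed.

Fact umul1r : right_id (Unitize 0 1) umul.
Proof. by move=> u; apply: uext_inj; rewrite !uextM uext1 mulr1. Qed.

Fact umulDl : left_distributive umul +%R.
Proof.
by move=> u v w; apply: uext_inj; rewrite !(uextM, uextD) mulrDl.
Qed.

Fact umulDr : right_distributive umul +%R.
Proof.
by move=> u v w; apply: uext_inj; rewrite !(uextM, uextD) mulrDr.
Qed.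

Fact umulZl (k : R[i]) u v : umul (k *: u) v = k *: umul u v.
Proof.
apply: uext_inj; rewrite !(uextM, uextZ).
by apply/funext => o; exact: esym (mulrA _ _ _).
Qed.

Fact umulZr (k : R[i]) u v : umul u (k *: v) = k *: umul u v.
Proof.
apply: uext_inj; rewrite !(uextM, uextZ).
by apply/funext => o; exact: mulrCA.
Qed.

Fact ustarK : involutive ustar.
Proof.
move=> u; apply: uext_inj; rewrite !uext_star.
by apply/funext => o; exact: conjcK.
Qed.

Fact ustarD : {morph ustar : u v / u + v}.
Proof.
move=> u v; apply: uext_inj; rewrite !(uext_star, uextD).
by apply/funext => o; exact: rmorphD.
Qed.

Fact ustarZ (k : R[i]) u : ustar (k *: u) = k^* *: ustar u.
Proof.
apply: uext_inj; rewrite !(uext_star, uextZ).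
by apply/funext => o; exact: rmorphM.
Qed.

Fact ustarM u v : ustar (umul u v) = umul (ustar v) (ustar u).
Proof.
apply: uext_inj; rewrite !(uext_star, uextM).
by apply/funext => o; rewrite [LHS]rmorphM mulrC.
Qed.

Fact unormM u v : `|umul u v| <= `|u| * `|v|.
Proof.
by rewrite !unormE -rmorphM lecR uextM supnormM//; exact: uext_bounded.
Qed.

Fact unorm_star u : `|umul (ustar u) u| = `|u| ^+ 2.
Proof.
rewrite !unormE -rmorphXn -supnorm_sqr; last exact: uext_bounded.
by rewrite uextM uext_star.
Qed.

HB.instance Definition _ := isCStarAlgebra.Build R unitization
  umulA umul1l umul1r umulDl umulDr umulZl umulZr ustarK ustarD ustarZ ustarM
  unormM unorm_star.

Definition C0_act (f : C0) u : C0 := C0_mul f (upart u) + uscalar u *: f.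
Definition C0_inner (f g : C0) : unitization := Unitize (C0_mul (C0_conj f) g) 0.

Lemma C0_actE (f : C0) u t : C0_act f u t = f t * uext u (Some t).
Proof.
by rewrite mulrDr [f t * uscalar u]mulrC.
Qed.

Fact C0_actDl (f g : C0) u : C0_act (f + g) u = C0_act f u + C0_act g u.
Proof. by apply: C0_ext => t; rewrite C0_addE !C0_actE mulrDl. Qed.

Fact C0_actDr (f : C0) u v : C0_act f (u + v) = C0_act f u + C0_act f v.
Proof. by apply: C0_ext => t; rewrite C0_addE !C0_actE uextD mulrDr. Qed.

Fact C0_actM (f : C0) u v : C0_act f (cmul u v) = C0_act (C0_act f u) v.
Proof. by apply: C0_ext => t; rewrite !C0_actE uextM mulrA. Qed.

Fact C0_actZ1 (f : C0) (k : R[i]) :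
  C0_act f (k *: (cone : unitization)) = k *: f.
Proof.
apply: C0_ext => t; rewrite C0_actE C0_scaleE uextZ uext1 mulrC.
by congr (_ * _); exact: mulr1.
Qed.

Fact C0_innerD (f g h : C0) : C0_inner f (g + h) = C0_inner f g + C0_inner f h.
Proof.
congr Unitize; last by rewrite addr0.
by apply: C0_ext => t /=; rewrite mulrDr.
Qed.

Fact C0_inner_act (f g : C0) u : C0_inner f (C0_act g u) = cmul (C0_inner f g) u.
Proof.
congr Unitize; last by rewrite mul0r.
by apply: C0_ext => t; rewrite !C0E; ring.
Qed.

Fact C0_inner_star (f g : C0) : C0_inner g f = cstar (C0_inner f g).
Proof.
congr Unitize; last by rewrite /= rmorph0.
apply: C0_ext => t; change ((g t)^* * f t = ((f t)^* * g t)^*).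
by rewrite mulrC -{1}(conjcK (f t)); exact: esym (rmorphM _ _ _).
Qed.

Fact C0_inner_pos (f : C0) : cpositive (C0_inner f f).
Proof.
exists (Unitize f 0); apply: uext_inj; rewrite uextM uext_star.
apply/funext => -[t|]; rewrite [RHS]/GRing.mul/=; last by rewrite mulr0.
by rewrite !addr0.
Qed.

Fact C0_norm_inner (f : C0) : `|f| ^+ 2 = `|C0_inner f f|.
Proof.
have -> : C0_inner f f = umul (ustar (Unitize f 0)) (Unitize f 0).
  apply: uext_inj; rewrite uextM uext_star.
  apply/funext => -[t|]; rewrite [RHS]/GRing.mul/=; last by rewrite mulr0.
  by rewrite !addr0.
rewrite unorm_star; congr (_ ^+ 2); apply/eqP; rewrite eq_le; apply/andP; split.
  rewrite C0_normE unormE lecR; have fb := uext_bounded (Unitize f 0).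
  apply: supnorm_le => [|t]; first exact: supnorm_ge0.
  by have := supnorm_ub (Some t) fb; rewrite /= addr0.
by apply: le_trans (unorm_le _ _) _; rewrite normr0 addr0.
Qed.

HB.instance Definition _ := isHilbertModule.Build R unitization C0
  C0_actDl C0_actDr C0_actM C0_actZ1 C0_innerD C0_inner_act C0_inner_star
  C0_inner_pos C0_norm_inner.

End Unitization.

(* Main.v *)
Require Import Defs.
From mathcomp Require Import all_boot all_order all_algebra.
From mathcomp Require Import complex finmap lra.
From mathcomp Require Import boolp classical_sets functions reals topology.
From mathcomp Require Import normedtype.
From mathcomp.analysis.showcase Require summability.

(** Evaluating the frame inequality at a point [t] where [y t = 1] turns it into
a statement about the numbers [sum_j |x_j(t)|^2]: they are bounded below by a
positive constant on all of [K].  The norm of the unitization is a sup norm, so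
convergence of the frame series at a function [y] equal to 1 on a compact set
[C], which Urysohn's lemma provides, is uniform convergence of this sum on [C].
Hence there is [c > 0] such that for each compact [C] some finite set [A] of
indices carries mass at least [c] at every point of [C], while any finite set
disjoint from [A] carries mass less than [c] there ([frame_mass_bounds]).

On the other hand, each [x_j] vanishes outside a compact set, because the
countably many compact sets [{|x_j| >= 1/n}] lie in a single compact set
([C0_compact_support]).  As [K] is not compact, there is a point [t] at which
any prescribed finitely many [x_j] vanish; all the mass at [t] is carried by
the other indices ([frame_mass_off_finite]).  Iterating this gives points [t_n]
and pairwise disjoint finite sets [G_n] of indices with mass at least [c] at
[t_n].  The countably many points [t_n] lie in one compact set [C].  The finite
set [A] attached to [C] is disjoint from some [G_n], whose mass at [t_n] would
then be both at least and less than [c]. *)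

Set Implicit Arguments.
Unset Strict Implicit.
Unset Printing Implicit Defensive.
Import Order.TTheory GRing.Theory Num.Theory.
Import numFieldNormedType.Exports.
Local Open Scope classical_set_scope.
Local Open Scope complex_scope.
Local Open Scope ring_scope.

(** * Moduli of complex numbers *)

Lemma modulus_real (R : realType) (r : R) : modulus r%:C = `|r|.
Proof. by rewrite /modulus normc_def/= expr0n/= addr0 sqrtr_sqr. Qed.

Lemma Re_le_modulus (R : realType) (z : R[i]) : `|complex.Re z| <= modulus z.
Proof.
case: z => a b; rewrite /modulus normc_def /= -sqrtr_sqr.
by rewrite ler_wsqrtr// lerDl sqr_ge0.
Qed.

Lemma modulus_sqr (R : realType) (z : R[i]) : z^* * z = (modulus z ^+ 2)%:C.
Proof. by rewrite mulrC -sqr_normc -modulusE rmorphXn. Qed.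

(** * Functions vanishing at infinity *)

(** Urysohn's lemma in the one-point compactification, which is compact
Hausdorff and hence normal: separating [C] from the point at infinity makes the
function vanish at infinity. *)
Lemma C0_urysohn (R : realType) (K : topologicalType) (C : set K) :
    hausdorff_space K -> locally_compact [set: K] -> compact C ->
  exists y : C0 R K, forall t, C t -> y t = 1.
Proof.
move=> hK lK cC.
pose opc := one_point_compactification K.
have hO : hausdorff_space opc by exact: one_point_compactification_hausdorff.
have nO : normal_space opc.
  by apply: compact_normal => //; exact: one_point_compactification_compact.
have clC : closed (Some @` C : set opc).
  apply: compact_closed => //; apply: continuous_compact => //.
  apply: continuous_subspaceT.
  exact: one_point_compactification_some_continuous.
have clN : closed ([set None] : set opc).
  by apply: compact_closed => //; exact: compact_set1.
have /(normal_uniform_separator nO clN clC) :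
    [set None] `&` (Some @` C) = set0 :> set opc.
  by apply/seteqP; split=> // _ [-> []].
move=> /(@uniform_separatorP _ R)[f [fc _ f0 f1]].
have fP : (fun t : K => (f (Some t))%:C) \in @C0_pred R K.
  apply/asboolP; split=> [t|e e0].
    apply/cvgrPdist_lt => _ /gt0_complex[e e0 ->].
    have /cvgrPdist_lt/(_ e e0) ft := fc (Some t).
    have : \forall s \near t, `|f (Some t) - f (Some s)| < e by exact: ft.
    by apply: filterS => s; rewrite -rmorphB modulus_lt modulus_real.
  have /cvgrPdist_lt/(_ e e0)[B [Bc _] Bf] := fc None.
  exists B => // t nBt; rewrite modulus_lt modulus_real.
  have := Bf (Some t); rewrite /= (f0 (f None)); last by exists None.
  by rewrite sub0r normrN; apply; left; exists t.
exists (MkC0 fP) => t Ct /=.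
by rewrite (f1 (f (Some t))) //; exists (Some t) => //; exists t.
Qed.

(** Outside a compact set containing all the sets [{|f| >= 1/(n+1)}], the
modulus of [f] is below every [1/(n+1)]. *)
Lemma C0_compact_support (R : realType) (K : topologicalType) (f : C0 R K) :
    (forall B : nat -> set K, (forall n, compact (B n)) ->
       exists2 B' : set K, compact B' & \bigcup_n B n `<=` B') ->
  exists2 B : set K, compact B & forall t, ~ B t -> f t = 0.
Proof.
move=> Kcc; have [_ fv] := C0P f.
have /choice[B BP] (n : nat) : exists B : set K,
    compact B /\ forall t, ~ B t -> modulus (f t) < n.+1%:R^-1.
  have [|B Bc fB] := fv n.+1%:R^-1; first by rewrite invr_gt0.
  by exists B; split=> // t /fB; rewrite modulus_lt.
have [D Dc BD] := Kcc B (fun n => (BP n).1).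
exists D => // t nDt; apply: modulus_eq0; apply/eqP.
rewrite eq_le modulus_ge0 andbT; apply/ler_addgt0Pr => e e0; rewrite add0r.
have [n ne] := @ltr_add_invr R 0 e e0.
rewrite add0r in ne; apply/ltW; apply: lt_trans ne; apply: (BP n).2 => Bt.
by apply: nDt; apply: BD; exists n.
Qed.

(** * The frame series at a point *)

Section FrameMass.
Variables (R : realType) (K : topologicalType) (J : choiceType).
Variable x : J -> C0 R K.

Definition frame_mass (A : {fset J}) (t : K) : R :=
  \sum_(j <- A) modulus (x j t) ^+ 2.

Lemma frame_massU (A G : {fset J}) t : [disjoint A & G]%fset ->
  frame_mass (A `|` G)%fset t = frame_mass A t + frame_mass G t.
Proof.
move=> AG; rewrite /frame_mass -big_cat; apply: perm_big; apply: uniq_perm.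
- exact: fset_uniq.
- rewrite cat_uniq !fset_uniq andbT /=; apply/hasPn => j Gj.
  by move/fdisjointP_sym: AG => /(_ j Gj).
- by move=> j; rewrite mem_cat inE.
Qed.

(** At a point where [y] takes the value 1, the frame coefficient
[<y, x_j><x_j, y>] is [|x_j|^2]. *)
Lemma uext_partial_sum (y : C0 R K) (A : {fset J}) t : y t = 1 ->
  uext (summability.partial_sum
    (frame_coef (A := unitization R K) (N := C0 R K) x y) A) (Some t)
  = (frame_mass A t)%:C.
Proof.
move=> yt; rewrite /summability.partial_sum /frame_mass.
rewrite (big_morph (fun u : unitization R K => uext u (Some t))
  (id1 := 0) (op1 := +%R)); last 2 first.
- by move=> u v; rewrite uextD.
- by rewrite /= addr0.
rewrite big_seq_fsetE rmorph_sum; apply: eq_bigr => j _.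
apply: etrans (modulus_sqr _).
set xj := x (val j).
transitivity (uext (umul (C0_inner y xj) (C0_inner xj y)) (Some t)) => //.
rewrite uextM [LHS]/(_ * _) /= !addr0 yt.
have -> : (1 : R[i])^* = 1 by exact: rmorph1.
by rewrite mul1r mulr1; exact: mulrC.
Qed.

Lemma uextB (u v : unitization R K) o : uext (u - v) o = uext u o - uext v o.
Proof. by rewrite uextD -scaleN1r uextZ scaleN1r. Qed.

Lemma uext_le_norm (u : unitization R K) o : `|uext u o| <= `|u|.
Proof. by rewrite unormE -modulusE lecR supnorm_ub//; exact: uext_bounded. Qed.

Lemma cle_uext (u v : unitization R K) o : cle u v -> uext u o <= uext v o.
Proof.
move=> [c vu]; have {}vu : v - u = umul (ustar c) c := vu.
have -> : v = u + umul (ustar c) c by rewrite -vu addrC subrK.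
rewrite uextD uextM uext_star lerDl.
rewrite [leRHS](_ : _ = (modulus (uext c o) ^+ 2)%:C) ?lecR ?sqr_ge0//.
exact: modulus_sqr.
Qed.

(** The frame constant and the compact set enter separately: [c] is half of the
lower frame constant [c1], and [A] is an index set beyond which the partial sums
of the series at [y] stay within [c1 / 4] of its sum in sup norm, where [y] is 1
on [C].  Over [C] the sum is at least [c1], so [A] has mass more than
[c1 - c1 / 4]; if [G] is disjoint from [A], its mass is the difference of two
partial sums, hence less than [c1 / 4 + c1 / 4]. *)
Lemma frame_mass_bounds :
    hausdorff_space K -> locally_compact [set: K] ->
    standard_frame (A := unitization R K) (N := C0 R K) x ->
  exists2 c : R, 0 < c & forall C : set K, compact C ->
    exists A : {fset J}, forall t, C t ->
      c <= frame_mass A t /\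
      forall G : {fset J}, [disjoint A & G]%fset -> frame_mass G t < c.
Proof.
move=> hK lK [c1 [c2 [c10 _ xP]]]; exists (c1 / 2); first by rewrite divr_gt0.
move=> C Cc; have [y yC] := C0_urysohn R hK lK Cc.
have [cv lo _] := xP y.
set S := summability.sum _ in lo.
have e0 : 0 < (c1 / 4)%:C :> R[i] by rewrite ltcR divr_gt0.
have FF := @summability.totally_filter J.
have /cvgrPdist_lt/(_ _ e0)[A _ SA] := cv.
exists A => t Ct.
have near_S (B : {fset J}) : (A `<=` B)%fset ->
    `|complex.Re (uext S (Some t)) - frame_mass B t| < c1 / 4.
  move=> AB.
  have := le_lt_trans (uext_le_norm _ (Some t)) (SA B AB).
  rewrite modulus_lt uextB uext_partial_sum ?yC//.
  apply: le_lt_trans.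
  have := Re_le_modulus (uext S (Some t) - (frame_mass B t)%:C).
  by rewrite raddfB.
have S_ge : c1 <= complex.Re (uext S (Some t)).
  have := cle_uext (Some t) lo; rewrite uextZ.
  have -> : (c1%:C *: uext (inner y y : unitization R K)) (Some t) = c1%:C.
    transitivity (c1%:C * ((y t)^* * y t + 0)) => //.
    by rewrite addr0 modulus_sqr yC// modulus_real normr1 expr1n mulr1.
  by rewrite lecE => /andP[].
have := near_S A (fsubset_refl A); rewrite ltr_norml => /andP[lA uA].
split; first by lra.
move=> G AG; have := near_S (A `|` G)%fset (fsubsetUl A G).
rewrite frame_massU // ltr_norml => /andP[lG uG]; lra.
Qed.

End FrameMass.

(** * Escaping from finitely many indices *)

(** The union of compact sets carrying the [x_j] with [j] in [A] is compact,
hence not all of [K].  At a point outside it the indices in [A] contribute no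
mass, so they may be removed from any finite set of mass at least [c]. *)
Lemma frame_mass_off_finite (R : realType) (K : topologicalType)
    (J : choiceType) (x : J -> C0 R K) (c : R) :
    ~ sigma_compact [set: K] ->
    (forall B : nat -> set K, (forall n, compact (B n)) ->
       exists2 B' : set K, compact B' & \bigcup_n B n `<=` B') ->
    (forall t, exists A : {fset J}, c <= frame_mass x A t) ->
  forall A : {fset J}, exists tG : K * {fset J},
    [disjoint tG.2 & A]%fset /\ c <= frame_mass x tG.2 tG.1.
Proof.
move=> Kns Kcc xc A.
have /choice[B BP] (j : J) : exists B : set K,
    compact B /\ forall t, ~ B t -> x j t = 0.
  by have [B] := C0_compact_support (x j) Kcc; exists B.
pose D := \big[setU/set0]_(j <- A) B j.
have Dc : compact D by apply: bigsetU_compact => j _; exact: (BP j).1.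
have [t nDt] : exists t, ~ D t.
  apply/existsNP => DT; apply: Kns; exists (fun=> D) => //.
  by apply/seteqP; split=> // t _; exists 0%N.
have xA j : j \in A -> x j t = 0.
  move=> Aj; apply: (BP j).2 => Bt; apply: nDt.
  by rewrite /D -bigcup_seq; exists j.
have [G cG] := xc t; exists (t, (G `\` A)%fset) => /=; split.
  by apply/fdisjointP => j; rewrite inE => /andP[].
apply: le_trans cG _; rewrite le_eqVlt; apply/orP; left; apply/eqP.
apply/esym/big_fset_incl; first exact: fsubsetDl.
move=> j Gj; rewrite inE Gj andbT negbK => /xA ->.
by rewrite /modulus normr0 expr0n.
Qed.

(** The sets [G (S n)], where [S n] accumulates the earlier ones, are pairwise
disjoint.  If all of them met [F], the cardinal of the part of [F] lying in
[S n] would increase with each [n], beyond that of [F]. *)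
Lemma disjoint_from_greedy (T : choiceType) (G : {fset T} -> {fset T}) :
    (forall A, [disjoint G A & A]%fset) ->
  forall F : {fset T}, exists n : nat,
    [disjoint F & G (iter n (fun A => A `|` G A)%fset fset0)]%fset.
Proof.
move=> GA F; apply: contrapT => /forallNP nF.
pose S n := iter n (fun A => A `|` G A)%fset fset0.
suff card n : (n <= #|` (F `&` S n)%fset|)%N.
  have := leq_trans (card #|` F|.+1) (fsubset_leq_card (fsubsetIl F _)).
  by rewrite ltnn.
elim: n => // n /leq_ltn_trans; apply; apply: fproper_ltn_card.
rewrite fproperE fsetIS ?fsubsetUl//=; apply/negP => sub.
apply: (nF n); apply/fdisjointP => j Fj; apply/negP => Gj.
have := fdisjointP (GA (S n)) j Gj.
have /(fsubsetP sub) : j \in (F `&` S n.+1)%fset by rewrite !inE Fj Gj orbT.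
by rewrite inE Fj => /= ->.
Qed.

(** * Absence of standard frames *)

Theorem mainTheorem3 (R : realType) (K : topologicalType)
    (K_hausdorff : hausdorff_space K)
    (K_locally_compact : locally_compact [set: K])
    (K_not_sigma_compact : ~ sigma_compact [set: K])
    (K_countable_compact : forall B : nat -> set K,
       (forall n, compact (B n)) ->
       exists2 B' : set K, compact B' & \bigcup_n B n `<=` B') :
  ~ exists (J : choiceType) (x : J -> C0 R K),
      standard_frame (A := unitization R K) (N := C0 R K) x.
Proof.
move=> [J [x xframe]].
have [c c0 xc] := frame_mass_bounds K_hausdorff K_locally_compact xframe.
have xpt t : exists A : {fset J}, c <= frame_mass x A t.
  have [A AP] := xc [set t] (@compact_set1 _ t).
  by exists A; have [] := AP t erefl.
have /choice[tG tGP] :=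
  frame_mass_off_finite K_not_sigma_compact K_countable_compact xpt.
pose S n := iter n (fun A => A `|` (tG A).2)%fset fset0.
have [C Cc tC] := K_countable_compact (fun n => [set (tG (S n)).1])
  (fun n => @compact_set1 _ _).
have [F FP] := xc C Cc.
have [n Fn] := disjoint_from_greedy (fun A => (tGP A).1) F.
have [|_ /(_ _ Fn)] := FP (tG (S n)).1; first by apply: tC; exists n.
by rewrite ltNge (tGP _).2.
Qed.
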